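(* Let $A\in\mathbb{R}^{n\times n}$ be the adjacency matrix of an undirected, unweighted network on $n$ nodes with at least one edge ($A$ symmetric, $a_{ii}=0$, $a_{ij}\in\{0,1\}$). Let $\mathbf{1}$ be the all-ones vector and $\mathbf{d}=A\mathbf{1}$. Let $c_0,c_1,c_2,\dots\ge 0$ be coefficients such that the series $\mathbf{x}=\left(c_0I+c_1A+c_2A^2+\cdots\right)\mathbf{1}$ converges. If \[ \mathbf{1}^TA^{k+1}\mathbf{1}\ \ge\ \mathbf{1}^TA^{k}\mathbf{1}\,\frac{\mathbf{1}^TA\mathbf{1}}{n} \] holds for every $k\ge 1$ for which $c_k>0$, then \[ \frac{\mathbf{d}^T\mathbf{x}}{\|\mathbf{d}\|_1}-\frac{\|\mathbf{x}\|_1}{n}\ \ge\ 0. \]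
   Context: $\|\mathbf{v}\|_1=\sum_i|v_i|$. *)

(* Defs.v *)
From HB Require Import structures.
From mathcomp Require Import all_boot all_order all_algebra.
From mathcomp Require Import all_classical all_reals all_analysis.
Set Implicit Arguments.
Unset Strict Implicit.
Unset Printing Implicit Defensive.
Import Order.TTheory GRing.Theory Num.Theory.
Import numFieldNormedType.Exports.
Local Open Scope classical_set_scope.
Local Open Scope ring_scope.

Definition is_adjacency (R : realType) (n : nat) (A : 'M[R]_n) : Prop :=
  [/\ A^T = A,
      forall i, A i i = 0
    & forall i j, A i j = 0 \/ A i j = 1].

Definition has_edge (R : realType) (n : nat) (A : 'M[R]_n) : Prop :=
  exists i j, A i j = 1.

Definition ones (R : realType) (n : nat) : 'cV[R]_n := const_mx 1.

Definition degrees (R : realType) (n : nat) (A : 'M[R]_n) : 'cV[R]_n :=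
  A *m ones R n.

Definition dot (R : realType) (n : nat) (u v : 'cV[R]_n) : R :=
  (u^T *m v) 0 0.

(* The library norm `|v| on matrices is the sup norm, hence this one. *)
Definition norm1 (R : realType) (n : nat) (v : 'cV[R]_n) : R :=
  \sum_(i < n) `|v i 0|.

Definition walks (R : realType) (n : nat) (A : 'M[R]_n) (k : nat) : R :=
  dot (ones R n) (A ^+ k *m ones R n).

Definition walk_series (R : realType) (n : nat) (A : 'M[R]_n) (c : nat -> R)
    (N : nat) : 'cV[R]_n :=
  (\sum_(k < N) c k *: A ^+ k) *m ones R n.

(* Main.v *)
(** The quantity to bound is the value at [x] of the linear functional
    [v |-> dot u v], where [u := d / |d|_1 - 1 / n], because every term of the
    series, hence [x] itself, has nonnegative entries.  At [A^k 1] this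
    functional is [walks k.+1 / walks 1 - walks k / n]: this vanishes for
    [k = 0] and is nonnegative whenever [k >= 1] and [c k > 0], by hypothesis.
    So it is nonnegative at all partial sums, and by continuity at [x]. *)
Require Import Defs.
From HB Require Import structures.
From mathcomp Require Import all_boot all_order all_algebra.
From mathcomp Require Import all_classical all_reals all_analysis.
Import Order.TTheory GRing.Theory Num.Theory.
Import numFieldNormedType.Exports.
Local Open Scope classical_set_scope.
Local Open Scope ring_scope.

Lemma dotE (R : realType) (n : nat) (u v : 'cV[R]_n) :
  dot u v = \sum_i u i 0 * v i 0.
Proof. by rewrite /dot mxE; apply: eq_bigr => i _; rewrite mxE. Qed.

Lemma dot_onesE (R : realType) (n : nat) (v : 'cV[R]_n) :
  dot (ones R n) v = \sum_i v i 0.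
Proof. by rewrite dotE; apply: eq_bigr => i _; rewrite mxE mul1r. Qed.

(** Read backwards, this merges the two quotients of the goal into one functional of [w], to which
    linearity and continuity apply. *)
Lemma dot_divB (R : realType) (n : nat) (a b : R) (u v w : 'cV[R]_n) :
  dot (a^-1 *: u - b^-1 *: v) w = dot u w / a - dot v w / b.
Proof.
rewrite !dotE !mulr_suml -sumrB; apply: eq_bigr => i _.
by rewrite !mxE mulrBl -!mulrA ![_^-1 * _]mulrC !mulrA.
Qed.

Lemma dot_sum_scale (R : realType) (n N : nat) (u : 'cV[R]_n) (c : nat -> R)
    (v : nat -> 'cV[R]_n) :
  dot u (\sum_(k < N) c k *: v k) = \sum_(k < N) c k * dot u (v k).
Proof.
rewrite /dot mulmx_sumr summxE; apply: eq_bigr => k _.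
by rewrite -scalemxAr mxE.
Qed.

Lemma dot_mulmx_sym (R : realType) (n : nat) (A : 'M[R]_n) (u v : 'cV[R]_n) :
  A^T = A -> dot (A *m u) v = dot u (A *m v).
Proof. by move=> Asym; rewrite /dot trmx_mul Asym mulmxA. Qed.

Lemma dot_continuous (R : realType) (n : nat) (u : 'cV[R]_n) :
  continuous (dot u).
Proof.
rewrite (_ : dot u = fun v => \sum_i u i 0 * v i 0); last first.
  by apply/funext => v; exact: dotE.
apply: continuous_big => [|i _ v]; first exact: add_continuous.
by apply: cvgMl_tmp; [exact: nbhs_filter|exact: coord_continuous].
Qed.

(** Makes the norm linear on the nonnegative cone, where both [degrees A] and the limit [x] lie. *)
Lemma norm1_ge0E (R : realType) (n : nat) (v : 'cV[R]_n) :
  (forall i, 0 <= v i 0) -> norm1 v = dot (ones R n) v.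
Proof.
by move=> v0; rewrite dot_onesE; apply: eq_bigr => i _; rewrite ger0_norm.
Qed.

Lemma expmx_ge0 (R : realType) (n : nat) (A : 'M[R]_n) (k : nat) :
  (forall i j, 0 <= A i j) -> forall i j, 0 <= (A ^+ k) i j.
Proof.
move=> A0; elim: k => [|k IHk] i j; first by rewrite expr0 mxE ler0n.
by rewrite exprS mxE sumr_ge0 // => l _; rewrite mulr_ge0.
Qed.

Lemma walk_seriesE (R : realType) (n N : nat) (A : 'M[R]_n) (c : nat -> R) :
  walk_series A c N = \sum_(k < N) c k *: (A ^+ k *m ones R n).
Proof.
by rewrite /walk_series mulmx_suml; apply: eq_bigr => k _; rewrite -scalemxAl.
Qed.

Lemma walk_series_ge0 (R : realType) (n N : nat) (A : 'M[R]_n) (c : nat -> R) :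
  (forall i j, 0 <= A i j) -> (forall k, 0 <= c k) ->
  forall i, 0 <= walk_series A c N i 0.
Proof.
move=> A0 c0 i; rewrite walk_seriesE summxE sumr_ge0 // => k _.
rewrite mxE mulr_ge0 // mxE sumr_ge0 // => j _.
by rewrite [ones _ _ _ _]mxE mulr1 expmx_ge0.
Qed.

(** By symmetry the factor [A] inside [degrees A] moves across the product and raises the exponent
    by one. *)
Lemma dot_degrees_expmx (R : realType) (n : nat) (A : 'M[R]_n) (k : nat) :
  A^T = A -> dot (degrees A) (A ^+ k *m ones R n) = walks A k.+1.
Proof.
by move=> Asym; rewrite /walks exprS -mulmxA /degrees dot_mulmx_sym.
Qed.

Lemma walks0 (R : realType) (n : nat) (A : 'M[R]_n) : walks A 0 = n%:R.
Proof.
rewrite /walks expr0 mul1mx dot_onesE.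
by under eq_bigr do rewrite mxE; rewrite sumr_const card_ord.
Qed.

(** The entry 1 of an edge makes its row sum positive, and all other entries only add to the
    total. *)
Lemma walks1_gt0 (R : realType) (n : nat) (A : 'M[R]_n) :
  (forall i j, 0 <= A i j) -> has_edge A -> 0 < walks A 1.
Proof.
move=> A0 [i [j Aij]]; rewrite /walks expr1 dot_onesE.
have row_ge0 k : 0 <= (A *m ones R n) k 0.
  by rewrite mxE sumr_ge0 // => l _; rewrite [ones _ _ _ _]mxE mulr1.
rewrite (bigD1 i) //= ltr_wpDr ?sumr_ge0 //.
rewrite mxE (bigD1 j) //= [ones _ _ _ _]mxE mulr1 Aij ltr_wpDr // sumr_ge0 //.
by move=> l _; rewrite [ones _ _ _ _]mxE mulr1.
Qed.

Theorem theorem2 (R : realType) (n : nat) (A : 'M[R]_n) (c : nat -> R)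
    (x : 'cV[R]_n)
    (hA : is_adjacency A)
    (hedge : has_edge A)
    (hc : forall k, 0 <= c k)
    (hx : walk_series A c N @[N --> \oo] --> x)
    (hwalk : forall k, (1 <= k)%N -> 0 < c k ->
       walks A k.+1 >= walks A k * (walks A 1 / n%:R)) :
  dot (degrees A) x / norm1 (degrees A) - norm1 x / n%:R >= 0.
Proof.
have [Asym _ A01] := hA.
have A0 i j : 0 <= A i j by case: (A01 i j) => ->.
have w1_gt0 : 0 < walks A 1 by exact: walks1_gt0.
have n_gt0 : 0 < n%:R :> R.
  (* An endpoint of the edge is an element of ['I_n], which rules out [n = 0]. *)
  by case: hedge => i _; rewrite ltr0n (leq_ltn_trans _ (ltn_ord i)).
have x_ge0 i : 0 <= x i 0.
  have xi : walk_series A c N i 0 @[N --> \oo] --> x i 0.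
    exact: (continuous_cvg _ (@coord_continuous _ _ _ i 0 x) hx).
  by apply: (cvgr_to_ge xi); apply: nearW => N; exact: walk_series_ge0.
have d_norm : norm1 (degrees A) = walks A 1.
  rewrite norm1_ge0E ?/walks ?expr1 // => i.
  by rewrite mxE sumr_ge0 // => j _; rewrite [ones _ _ _ _]mxE mulr1.
rewrite d_norm norm1_ge0E // -dot_divB.
set u := _ *: _ - _.
apply: (cvgr_to_ge (continuous_cvg _ (@dot_continuous _ _ u x) hx)).
apply: nearW => N /=.
rewrite walk_seriesE (dot_sum_scale _ _ _ _ _ (fun k => A ^+ k *m ones R n)).
rewrite sumr_ge0 // => k _.
(* [hwalk] says nothing when [c k] vanishes, but then the whole term is zero. *)
have [->|ck0] := eqVneq (c k) 0; first by rewrite mul0r.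
rewrite mulr_ge0 // dot_divB dot_degrees_expmx // -/(walks A k) subr_ge0.
(* [hwalk] starts at [k = 1]; for [k = 0] both quotients equal 1, their denominators being
   positive. *)
have [->|k_gt0] := posnP k; first by rewrite walks0 !divff // gt_eqF.
(* Multiplying by [walks A 1 > 0] gives the inequality of [hwalk]. *)
rewrite ler_pdivlMr // mulrAC -mulrA.
by apply: hwalk; rewrite // lt_def ck0 hc.
Qed.
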